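(* There exists a family $\mathcal F_1$ of $5$ axis-parallel rectangles such that $\pi_L(\mathcal F_1)\ge \frac{6}{5}\,\pi(\mathcal F_1)$.
   Context: For a finite family $\mathcal F$ of closed axis-parallel rectangles in the plane, a point set $P\subset\mathbb R^2$ is $\mathcal F$-piercing if every translate of every rectangle in $\mathcal F$ contains a point of $P$. The density of a point set $P$ is $\limsup_{r\to\infty} |P\cap[-r,r]^2|/(2r)^2$. $\pi(\mathcal F)$ is the infimum of the densities of $\mathcal F$-piercing point sets, and $\pi_L(\mathcal F)$ is the infimum of the densities of $\mathcal F$-piercing lattices, where a lattice $\{iu+jv:i,j\in\mathbb Z\}$ ($u,v$ linearly independent) has density $1/|\det[u,v]|$. *)

(* Defs.v *)
From mathcomp Require Import all_boot all_order all_algebra.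
From mathcomp Require Import all_classical all_reals all_analysis.
Set Implicit Arguments. Unset Strict Implicit. Unset Printing Implicit Defensive.
Import Order.TTheory GRing.Theory Num.Theory numFieldNormedType.Exports.
Local Open Scope classical_set_scope.
Local Open Scope ring_scope.

Section Piercing.
Variable R : realType.

(* A closed axis-parallel rectangle [a,b] x [c,d], encoded as ((a,b),c),d. *)
Definition rect (q : R * R * R * R) : set (R * R) :=
  [set p | q.1.1.1 <= p.1 <= q.1.1.2 /\ q.1.2 <= p.2 <= q.2].

Definition proper_rect (q : R * R * R * R) : Prop :=
  q.1.1.1 < q.1.1.2 /\ q.1.2 < q.2.

Definition translate (t : R * R) (A : set (R * R)) : set (R * R) :=
  [set p | A (p.1 - t.1, p.2 - t.2)].

Definition piercing (F : seq (R * R * R * R)) (P : set (R * R)) : Prop :=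
  forall q, q \in F -> forall t : R * R, exists p, P p /\ translate t (rect q) p.

Definition box (r : R) : set (R * R) := [set p | `|p.1| <= r /\ `|p.2| <= r].

(* |P /\ [-r,r]^2| as an extended real (+oo if infinite) *)
Definition count_in (P : set (R * R)) (r : R) : \bar R :=
  \esum_(p in P `&` box r) 1%E.

Definition density (P : set (R * R)) : \bar R :=
  limf_esup (fun r : R => (count_in P r * ((2 * r) ^+ 2)^-1%:E)%E) +oo.

Definition pi_dens (F : seq (R * R * R * R)) : \bar R :=
  ereal_inf [set density P | P in [set P | piercing F P]].

Definition lattice (u v : R * R) : set (R * R) :=
  [set p | exists i j : int, p = (i%:~R * u.1 + j%:~R * v.1, i%:~R * u.2 + j%:~R * v.2)].

Definition det2 (u v : R * R) : R := u.1 * v.2 - u.2 * v.1.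

Definition pi_lat (F : seq (R * R * R * R)) : \bar R :=
  ereal_inf [set (`|det2 uv.1 uv.2|^-1)%:E | uv in
    [set uv : (R * R) * (R * R) | det2 uv.1 uv.2 != 0 /\ piercing F (lattice uv.1 uv.2)]].

End Piercing.

(* Main.v *)
(** The family consists of the rectangles 6x1, 4x2, 3x3, 2x4 and 1x6. A
    6-periodic set with six points per period, one in each row and column of
    the 6x6 torus, meets every w x h block of Z^2 for each w x h in the family,
    so the piercing density is at most 1/6.

    Conversely, let [u = (a, b)], [v = (c, -d)] with [a, b, c, d >= 0] be a basis
    of a piercing lattice. The open rectangle with [0] and [u + v] on its
    vertical sides and [u] and [v] on its horizontal sides has size
    (a + c) x (b + d) and contains no lattice point, so for each w x h in the
    family [a + c <= w] or [b + d <= h]. Adding one basis vector to the other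
    gives the next such basis, with a wider and lower empty rectangle, and
    subtracting gives the previous one. Around the place in this chain where
    the width passes 3, finitely many of these constraints force the
    determinant [a * d + b * c] to be at most 5. *)

Require Import Defs.
From mathcomp Require Import all_boot all_order all_algebra.
From mathcomp Require Import all_classical all_reals all_analysis.
From mathcomp Require Import finmap ring lra zify.
Import Order.TTheory GRing.Theory Num.Theory numFieldNormedType.Exports.
Local Open Scope classical_set_scope.
Local Open Scope ring_scope.

Set Implicit Arguments.
Unset Strict Implicit.
Unset Printing Implicit Defensive.

(** * The determinant bound for abstract chains of bases *)

Definition fits (R : realType) (a b c d w h : R) : Prop := a + c <= w \/ b + d <= h.

(* [Q a b c d] stands for: up to the symmetries of the square, [(a, b)] and
   [(c, - d)] form a basis of a fixed lattice of determinant [D]. *)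
Record basis_chain (R : realType) (Q : R -> R -> R -> R -> Prop) (D : R) : Prop :=
  BasisChain {
  chain_ge0 : forall a b c d, Q a b c d -> [/\ 0 <= a, 0 <= b, 0 <= c & 0 <= d];
  chain_det : forall a b c d, Q a b c d -> D = a * d + b * c;
  chain_fit61 : forall a b c d, Q a b c d -> fits a b c d 6 1;
  chain_fit42 : forall a b c d, Q a b c d -> fits a b c d 4 2;
  chain_fit33 : forall a b c d, Q a b c d -> fits a b c d 3 3;
  chain_fit24 : forall a b c d, Q a b c d -> fits a b c d 2 4;
  chain_fit16 : forall a b c d, Q a b c d -> fits a b c d 1 6;
  chain_refl : forall a b c d, Q a b c d -> Q c d a b;
  chain_tr : forall a b c d, Q a b c d -> Q b a d c;
  chain_next : forall a b c d, Q a b c d -> d <= b -> Q (a + c) (b - d) c d }.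

Lemma chain_forward (R : realType) (Q : R -> R -> R -> R -> Prop) (D : R) :
  basis_chain Q D -> forall a b c d, Q a b c d ->
  d <= b /\ Q (a + c) (b - d) c d \/ b <= d /\ Q a b (c + a) (d - b).
Proof.
move=> ch a b c d Qq; have [db|/ltW bd] := leP d b; [left|right]; split => //.
  exact: (chain_next ch).
by apply/(chain_refl ch)/(chain_next ch) => //; apply: (chain_refl ch).
Qed.

(** Transposition exchanges width and height, so narrowing a basis is widening its transpose. *)
Lemma chain_backward (R : realType) (Q : R -> R -> R -> R -> Prop) (D : R) :
  basis_chain Q D -> forall a b c d, Q a b c d ->
  c <= a /\ Q (a - c) (b + d) c d \/ a <= c /\ Q a b (c - a) (d + b).
Proof.
move=> ch a b c d /(chain_tr ch) /(chain_forward ch).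
by case=> -[? /(chain_tr ch) ?]; [left|right].
Qed.

(* Along each branch the constraints confine [(p, c)] and [(q, d)] to two convex
   polygons, and [nra] bounds the bilinear form [p * d + q * c] on their product. *)
Lemma chain_det_le5_crossing (R : realType) (Q : R -> R -> R -> R -> Prop) (D : R) :
  basis_chain Q D -> forall p q c d, Q p q c d -> Q (p - c) (q + d) c d ->
  p <= 3 -> c <= p -> 3 <= p + c -> q + d <= 3 -> D <= 5.
Proof.
move=> ch p q c d Q0 Qm p3 cp pc qd.
have [p0 q0 c0 d0] := chain_ge0 ch Q0.
rewrite (chain_det ch Q0).
  (* At most two steps forward from [Q0] and two back from [Qm] are examined; each use of a
     [chain_fit] field splits on whether the width or the height is the small one. *)
  have [[? Q1]|[? Q2]] := chain_forward ch Q0.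
  - have [[? Q3]|[? Q4]] := chain_backward ch Qm.
    + have [[? Q5]|[? Q6]] := chain_forward ch Q1.
      * have [?|?] := chain_fit42 ch Q0.
        -- have [[? Q7]|[? Q8]] := chain_backward ch Q3.
          ++ by nra.
          ++ have [?|?] := chain_fit16 ch Q8.
            ** by nra.
            ** by nra.
        -- by nra.
      * have [?|?] := chain_fit61 ch Q6.
        -- by nra.
        -- have [[? Q9]|[? Q10]] := chain_backward ch Q3.
          ++ by nra.
          ++ have [?|?] := chain_fit16 ch Q10.
            ** by nra.
            ** by nra.
    + have [?|?] := chain_fit42 ch Q0.
      * have [?|?] := chain_fit16 ch Q4.
        -- by nra.
        -- have [[? Q11]|[? Q12]] := chain_backward ch Q4.
          ++ by nra.
          ++ have [?|?] := chain_fit16 ch Q12.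
            ** by nra.
            ** by nra.
      * have [?|?] := chain_fit61 ch Q1.
        -- by nra.
        -- have [?|?] := chain_fit24 ch Q4.
          ++ by nra.
          ++ by nra.
  - have [?|?] := chain_fit24 ch Qm.
    + have [?|?] := chain_fit42 ch Q2.
      * by nra.
      * have [[? Q13]|[? Q14]] := chain_backward ch Qm.
        -- by nra.
        -- have [?|?] := chain_fit16 ch Q14.
          ++ by nra.
          ++ by nra.
    + have [?|?] := chain_fit42 ch Q0.
      * have [?|?] := chain_fit61 ch Q2.
        -- have [[? Q15]|[? Q16]] := chain_forward ch Q2.
          ++ have [?|?] := chain_fit61 ch Q15.
            ** by nra.
            ** by nra.
          ++ have [?|?] := chain_fit61 ch Q16.
            ** by nra.
            ** by nra.
        -- by nra.
      * have [?|?] := chain_fit61 ch Q2.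
        -- have [[? Q17]|[? Q18]] := chain_forward ch Q2.
          ++ by nra.
          ++ have [?|?] := chain_fit61 ch Q18.
            ** by nra.
            ** by nra.
        -- have [[? Q19]|[? Q20]] := chain_backward ch Qm.
          ++ by nra.
          ++ have [?|?] := chain_fit24 ch Q20.
            ** by nra.
            ** by nra.
Qed.

Lemma finite_set_argmin (R : realType) (T : choiceType) (A : set T) (f : T -> R) :
  finite_set A -> A !=set0 -> exists2 x, A x & forall y, A y -> f x <= f y.
Proof.
move=> /finite_seqP[s ->] [x0]; elim: s => // x s IH in x0 *.
have [-> _|/eqP s0 _] := eqVneq s [::].
  by exists x => [|y] /=; rewrite inE// => /eqP ->.
have [y ys ymin] : exists2 y, y \in s & forall z, z \in s -> f y <= f z.
  by case: s IH s0 => // y s IH _; apply: (IH y); rewrite /= mem_head.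
have [xy|/ltW yx] := leP (f x) (f y); [exists x|exists y];
  rewrite /= ?mem_head ?inE ?ys ?orbT// => z; rewrite inE => /orP[/eqP ->|zs] //.
  exact: le_trans xy (ymin _ zs).
exact: ymin.
Qed.

(* If a basis vector is horizontal, the rows of the lattice are [b] apart and
   empty rectangles of height [b] have unbounded width. *)
Lemma chain_det_le5_horizontal (R : realType) (Q : R -> R -> R -> R -> Prop) (D : R) :
  basis_chain Q D -> forall a b c, Q a b c 0 -> a + c <= 3 -> D <= 5.
Proof.
move=> ch a b c Q0 ac.
have [a0 b0 c0 _] := chain_ge0 ch Q0; rewrite (chain_det ch Q0).
have [->|cn0] := eqVneq c 0; first by lra.
have cp : 0 < c by rewrite lt_neqAle eq_sym cn0.
have Qn n : Q (a + n%:R * c) b c 0.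
  elim: n => [|n IH]; first by rewrite mul0r addr0.
  have := chain_next ch IH b0.
  by rewrite subr0 -addrA -{2}[c]mul1r -mulrDl natr1.
(* More than [6 / c] additions of [c] push the width beyond 6, so the 6x1 constraint gives [b <= 1]
   and [D = b * c <= 3]. *)
have := chain_fit61 ch (Qn (Num.truncn (6 / c)).+1).
case=> h; last by nra.
have := truncnS_gt (6 / c); rewrite ltr_pdivrMr//; nra.
Qed.

(** For [d > 0] the next basis has height [b < b + d], so by minimality its width exceeds 3, and the
    3x3 constraint makes its height at most 3: the crossing lies between the two. For [d = 0] the
    height does not drop, and the horizontal case applies. *)
Lemma chain_det_le5_lowest (R : realType) (Q : R -> R -> R -> R -> Prop) (D : R) :
  basis_chain Q D -> forall a b c d, Q a b c d -> a + c <= 3 -> d <= b ->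
  (forall a' b' c' d', Q a' b' c' d' -> a' + c' <= 3 -> b + d <= b' + d') -> D <= 5.
Proof.
move=> ch a b c d Q0 ac db minh.
have [a0 b0 c0 d0] := chain_ge0 ch Q0.
have Q1 := chain_next ch Q0 db.
have [dz|dn0] := eqVneq d 0.
  by move: Q0; rewrite dz => Q0; exact: (chain_det_le5_horizontal ch Q0 ac).
have dp : 0 < d by rewrite lt_neqAle eq_sym dn0.
have wide : 3 < a + c + c.
  rewrite ltNge; apply/negP => small; have := minh _ _ _ _ Q1 small; lra.
have low : b - d + d <= 3 by have [h|h] := chain_fit33 ch Q1; lra.
apply: (chain_det_le5_crossing ch Q1) => //; try lra.
by rewrite addrK subrK.
Qed.

Lemma chain_det_le5 (R : realType) (Q : R -> R -> R -> R -> Prop) (D : R) :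
  basis_chain Q D -> (exists a b c d, Q a b c d) ->
  (forall M, finite_set [set z : R * R * R * R |
     Q z.1.1.1 z.1.1.2 z.1.2 z.2 /\
     [/\ z.1.1.1 <= M, z.1.1.2 <= M, z.1.2 <= M & z.2 <= M]]) ->
  D <= 5.
Proof.
move=> ch [a1 [b1 [c1 [d1 Q1]]]] fin.
(* By the 3x3 constraint, a basis or its transpose has width at most 3. *)
have [a [b [c [d [Q0 ac]]]]] : exists a b c d, Q a b c d /\ a + c <= 3.
  have [h|h] := chain_fit33 ch Q1; first by exists a1, b1, c1, d1.
  by exists b1, a1, d1, c1; split => //; apply: (chain_tr ch).
(* The cut at height [b + d] makes the set finite, and its lowest element is still lowest among all
   bases of width at most 3. *)
pose A := [set z : R * R * R * R | Q z.1.1.1 z.1.1.2 z.1.2 z.2 /\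
  (z.1.1.1 + z.1.2 <= 3 /\ z.1.1.2 + z.2 <= b + d)].
have finA : finite_set A.
  apply: sub_finite_set (fin (3 + b + d)) => -[[[a' b'] c'] d'] [/= Q' [h1 h2]].
  have [? ? ? ?] := chain_ge0 ch Q'; have [? ? ? ?] := chain_ge0 ch Q0.
  by split => //; split; lra.
have [|[[[a' b'] c'] d'] [/= Q' [w' h']] minA] :=
  @finite_set_argmin R _ A (fun z => z.1.1.2 + z.2) finA; first by exists (a, b, c, d).
have minh a2 b2 c2 d2 : Q a2 b2 c2 d2 -> a2 + c2 <= 3 -> b' + d' <= b2 + d2.
  move=> Q2 w2; have [h2|/ltW h2] := leP (b2 + d2) (b + d); last exact: le_trans h2.
  by apply: (minA (a2, b2, c2, d2)).
have [db|/ltW bd] := leP d' b'.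
  exact: (chain_det_le5_lowest ch Q').
apply: (chain_det_le5_lowest ch (chain_refl ch Q')) => //; first by lra.
by move=> a2 b2 c2 d2 Q2 w2; rewrite addrC; apply: minh Q2 w2.
Qed.

(** * The 6-periodic piercing set and its density *)

Definition pierces (R : realType) (L : set (R * R)) (w h : R) : Prop :=
  forall t : R * R, exists p, L p /\
    t.1 <= p.1 <= t.1 + w /\ t.2 <= p.2 <= t.2 + h.

Lemma piercesE (R : realType) (L : set (R * R)) (w h : R) : pierces L w h <->
  forall t, exists p, L p /\ translate t (rect (0, w, 0, h)) p.
Proof.
rewrite /pierces /translate /rect /=.
by split=> pL t; have [p [Lp [/andP[h1 h2] /andP[h3 h4]]]] := pL t;
  exists p; do !split => //; apply/andP; split; lra.
Qed.

Lemma esum1_le_size (R : realType) (T : choiceType) (A : set T) (s : seq T) :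
  A `<=` [set` s] -> (\esum_(x in A) 1%E <= (size s)%:R%:E :> \bar R)%E.
Proof.
move=> As; apply: ge_ereal_sup => _ [X [finX XA] <-].
rewrite fsbig_finite//= sumEFin lee_fin big_const_seq count_predT iter_addr_0.
rewrite ler_nat; apply: uniq_leq_size => [|x]; first exact: fset_uniq.
by rewrite in_fset_set// => /set_mem /XA /As.
Qed.

Lemma density_le (R : realType) (P : set (R * R)) (D A B : R) :
  (forall r, 1 <= r -> (count_in P r <= (D * (2 * r) ^+ 2 + A * r + B)%:E)%E) ->
  (density P <= D%:E)%E.
Proof.
move=> cP; apply/lee_addgt0Pr => e e0; rewrite -EFinD.
(* Beyond [r0] one has [|A| + |B| <= e * r], so the lower-order terms are absorbed by
   [e * (2 * r) ^+ 2]. *)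
pose r0 := 1 + (`|A| + `|B|) / e.
have r01 : 1 <= r0 by rewrite lerDl divr_ge0 ?addr_ge0 // ltW.
apply: ge_ereal_inf; exists
  (ereal_sup [set (count_in P r * ((2 * r) ^+ 2)^-1%:E)%E | r in [set r | r0 < r]]).
  by exists [set r | r0 < r] => //; apply: nbhs_pinfty_gt; exact: num_real.
apply: ge_ereal_sup => _ [r /= rr <-].
have r1 : 1 <= r by lra.
have q0 : 0 < (2 * r) ^+ 2 by rewrite exprn_gt0//; lra.
apply: le_trans (lee_wpmul2r _ (cP r r1)) _.
  by rewrite lee_fin invr_ge0 ltW.
rewrite -EFinM lee_fin ler_pdivrMr//.
have h : `|A| + `|B| <= e * r.
  by rewrite mulrC -ler_pdivrMr//; move: rr; rewrite /r0; lra.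
have hA := ler_norm A; have hB := ler_norm B.
have nB := normr_ge0 B.
have : A * r + B <= (`|A| + `|B|) * r by nra.
have : (`|A| + `|B|) * r <= e * r * r by rewrite ler_wpM2r//; lra.
rewrite expr2; nra.
Qed.

(** Column [k] of the 6x6 torus has its point in the row given by entry [k]. Cyclically adjacent
    columns have rows at least 2 apart modulo 6, which is what 2x4 blocks require. *)
Definition hexperm : seq nat := [:: 0; 2; 4; 1; 5; 3]%N.

Definition hexset (R : realType) : set (R * R) :=
  [set p | exists (k : nat) (i j : int), (k < 6)%N /\
     p = (6 * i%:~R + k%:R, 6 * j%:~R + (nth 0%N hexperm k)%:R)].

Arguments hexset R : clear implicits.

(** Points in the box have both cell indices between [-m] and [m], leaving [6 * (2 * m + 1) ^ 2]
    candidates. Since [m <= r / 6 + 1], this is at most [6 * (r / 3 + 3) ^ 2], which expands to the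
    bound. *)
Lemma count_hexset (R : realType) (r : R) : 1 <= r ->
  (count_in (hexset R) r <= (6^-1 * (2 * r) ^+ 2 + 12 * r + 54)%:E)%E.
Proof.
move=> r1.
pose m := Num.truncn ((r + 6) / 6).
have hm : m%:R <= (r + 6) / 6 by rewrite truncn_le// divr_ge0//; lra.
have hm1 : (r + 6) / 6 < m.+1%:R by rewrite truncnS_gt.
pose z (t : nat) : R := t%:R - m%:R.
pose s := [seq (6 * z ij.1 + k%:R, 6 * z ij.2 + (nth 0%N hexperm k)%:R) |
  k <- iota 0 6, ij <- [seq (i, j) | i <- iota 0 (2 * m + 1), j <- iota 0 (2 * m + 1)]].
have bnd (i : int) (k : nat) : (k < 6)%N -> `|6 * i%:~R + k%:R| <= r ->
    exists2 t, t \in iota 0 (2 * m + 1) & i%:~R = z t.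
  move=> k6; rewrite ler_norml => /andP[h1 h2].
  have k5 : k%:R <= 5 :> R by rewrite ler_nat.
  have k0 : 0 <= k%:R :> R by [].
  have im : - m%:Z <= i <= m%:Z.
    have hm1' : (r + 6) / 6 < m%:~R + 1 :> R by rewrite -pmulrn natr1.
    rewrite lerNl -!ltzD1 -!(ltr_int R) !intrD intrN.
    by apply/andP; split; lra.
  exists `|(i + m%:Z)%R|%N; first by rewrite mem_iota; lia.
  rewrite /z natr_absz ger0_norm ?intrD; first by rewrite -pmulrn addrK.
  by lia.
apply: (@le_trans _ _ (size s)%:R%:E).
  apply: esum1_le_size => p [[k [i [j [k6 ->]]]] [/= bi bj]].
  have p6 : (nth 0 hexperm k < 6)%N 
    by apply: (allP (isT : all (gtn 6) hexperm)); rewrite mem_nth.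
  have [ti si ->] := bnd _ _ k6 bi; have [tj sj ->] := bnd _ _ p6 bj.
  apply/allpairsP; exists (k, (ti, tj)); split => //; first by rewrite mem_iota.
  by apply/allpairsP; exists (ti, tj).
rewrite !size_allpairs !size_iota lee_fin !natrM natrD !natrM; nra.
Qed.

(** A closed interval of integer length [w] contains the [w] consecutive integers starting at the
    ceiling of its left end. Every translate thus contains a w x h block of integer points, and
    periodicity leaves 36 positions to check by computation. *)
Lemma hexset_block (R : realType) (w h : nat) :
  all (fun x => all (fun y => has (fun i => has (fun j =>
    (nth 0 hexperm ((x + i) %% 6) == (y + j) %% 6)%N) (iota 0 h)) (iota 0 w))
    (iota 0 6)) (iota 0 6) ->
  pierces (hexset R) w%:R h%:R.
Proof.
move=> /allP chk [t1 t2] /=.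
have ceilP (t : R) : exists (A : int) (x : nat),
    (x < 6)%N /\ t <= 6 * A%:~R + x%:R < t + 1.
  exists (Num.ceil t %/ 6)%Z, `|(Num.ceil t %% 6)%Z|%N.
  have m0 : (0 <= Num.ceil t %% 6)%Z by rewrite modz_ge0.
  have m6 : (Num.ceil t %% 6 < 6)%Z by rewrite ltz_pmod.
  split; first by lia.
  have -> : 6 * (Num.ceil t %/ 6)%Z%:~R + `|(Num.ceil t %% 6)%Z|%N%:R =
      (Num.ceil t)%:~R :> R.
    have e6 : 6 = 6%:~R :> R by [].
    by rewrite natr_absz ger0_norm// mulrC e6 -intrM -intrD -divz_eq.
  have := ceilB1_lt t; rewrite intrB => ?; rewrite ceil_ge/=; lra.
have [A [x [x6 /andP[hx1 hx2]]]] := ceilP t1.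
have [B [y [y6 /andP[hy1 hy2]]]] := ceilP t2.
have /chk/allP/(_ y) : x \in iota 0 6 by rewrite mem_iota.
rewrite mem_iota => /(_ y6) /hasP[i]; rewrite mem_iota => iw /hasP[j].
rewrite mem_iota => jh /eqP e.
exists (6 * A%:~R + (x + i)%:R, 6 * B%:~R + (y + j)%:R); split.
  exists ((x + i) %% 6)%N, (A + ((x + i) %/ 6)%N%:Z), (B + ((y + j) %/ 6)%N%:Z).
  split; first by rewrite ltn_mod.
  rewrite e {1}(divn_eq (x + i) 6) {1}(divn_eq (y + j) 6).
  by congr pair; rewrite intrD -pmulrn natrD natrM; ring.
have iw' : i%:R + 1 <= w%:R :> R by rewrite natr1 ler_nat.
have jh' : j%:R + 1 <= h%:R :> R by rewrite natr1 ler_nat.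
have i0 : 0 <= i%:R :> R by []. have j0 : 0 <= j%:R :> R by [].
by rewrite /= !natrD; split; apply/andP; split; lra.
Qed.

(** * Changes of basis and empty rectangles *)

Definition basis_of (R : realType) (L : set (R * R)) (D : R) (u v : R * R) : Prop :=
  lattice u v = L /\ `|det2 u v| = D.

Lemma lattice_subset (R : realType) (u v u' v' : R * R) :
  lattice u v u' -> lattice u v v' -> lattice u' v' `<=` lattice u v.
Proof.
move=> [i [j ->]] [k [l ->]] _ [m [n ->]] /=.
exists (m * i + n * k), (m * j + n * l).
by rewrite !intrD !intrM; congr pair; ring.
Qed.

Lemma basis_of_comb (R : realType) (L : set (R * R)) (D : R) (u v u' v' : R * R)
    (i j k l : int) : (i * l - j * k) ^+ 2 = 1 ->
  u' = (i%:~R * u.1 + j%:~R * v.1, i%:~R * u.2 + j%:~R * v.2) ->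
  v' = (k%:~R * u.1 + l%:~R * v.1, k%:~R * u.2 + l%:~R * v.2) ->
  basis_of L D u v -> basis_of L D u' v'.
Proof.
set e := i * l - j * k => e2 u'E v'E [<- <-].
have e2R : e%:~R * e%:~R = 1 :> R by rewrite -intrM -expr2 e2.
have eE : e%:~R = i%:~R * l%:~R - j%:~R * k%:~R :> R by rewrite intrB !intrM.
have e1 (x : R) : x = e%:~R * (i%:~R * l%:~R - j%:~R * k%:~R) * x.
  by rewrite -eE e2R mul1r.
split.
  apply/seteqP; split.
    by apply: lattice_subset; [exists i, j|exists k, l].
  (* The inverse matrix is [e] times the adjugate, because [e] is its own inverse. *)
  apply: lattice_subset; [exists (e * l), (- (e * j))|exists (- (e * k)), (e * i)];
    rewrite u'E v'E !intrN !intrM /= [LHS]surjective_pairing;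
    by congr pair; rewrite [LHS]e1; ring.
have -> : det2 u' v' = e%:~R * det2 u v by rewrite /det2 u'E v'E eE /=; ring.
rewrite normrM; suff -> : `|e%:~R| = 1 :> R by rewrite mul1r.
by apply/eqP; rewrite -sqr_norm_eq1 ?expr2 e2R.
Qed.

Lemma basis_of_fits (R : realType) (L : set (R * R)) (D w h a b c d : R) :
  pierces L w h -> 0 <= a -> 0 <= b -> 0 <= c -> 0 <= d ->
  basis_of L D (a, b) (c, - d) -> fits a b c d w h.
Proof.
move=> pL a0 b0 c0 d0 [LE _]; have [ac|ac] := leP (a + c) w; first by left.
have [bd|bd] := leP (b + d) h; first by right.
(* This translate is centred in the open rectangle spanned by the basis. *)
have [p []] := pL ((a + c - w) / 2, (b - d - h) / 2).
rewrite -LE => -[i [j ->]] /= [/andP[x1 x2] /andP[y1 y2]].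
have int_cases (m : int) : m%:~R <= 0 :> R \/ 1 <= m%:~R :> R.
  have [m0|m0] := leP m 0; first by left; rewrite lerz0.
  by right; rewrite ler1z -gtz0_ge1.
(* The four sign patterns put [i * u + j * v] on or beyond the left, bottom, top and right sides
   respectively. *)
have [i0|i1] := int_cases i; have [j0|j1] := int_cases j; exfalso; nra.
Qed.

(** The alternatives are the symmetries of the square modulo [-1], which preserves every lattice;
    including all four makes the relation closed under reflection and transposition. *)
Definition chain_of (R : realType) (L : set (R * R)) (D a b c d : R) : Prop :=
  [/\ 0 <= a, 0 <= b, 0 <= c & 0 <= d] /\
  (basis_of L D (a, b) (c, - d) \/ basis_of L D (c, d) (a, - b) \/
   basis_of L D (b, a) (d, - c) \/ basis_of L D (d, c) (b, - a)).

Lemma chain_of_fits (R : realType) (L : set (R * R)) (D w h a b c d : R) :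
  pierces L w h -> pierces L h w -> chain_of L D a b c d -> fits a b c d w h.
Proof.
move=> pwh phw [[a0 b0 c0 d0]]; rewrite /fits.
case=> [/(basis_of_fits pwh a0 b0 c0 d0)//|].
case=> [/(basis_of_fits pwh c0 d0 a0 b0)|]; first by rewrite /fits addrC (addrC d).
case=> [/(basis_of_fits phw b0 a0 d0 c0)|/(basis_of_fits phw d0 c0 b0 a0)];
  rewrite /fits; first by case; [right|left].
by rewrite addrC (addrC c); case; [right|left].
Qed.

Lemma basis_chain_of (R : realType) (L : set (R * R)) (D : R) :
  pierces L 6 1 -> pierces L 4 2 -> pierces L 3 3 -> pierces L 2 4 ->
  pierces L 1 6 -> basis_chain (chain_of L D) D.
Proof.
move=> p61 p42 p33 p24 p16; split.
- by move=> a b c d [].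
- move=> a b c d [[a0 b0 c0 d0]].
  have h : `|a * d + b * c| = a * d + b * c by rewrite ger0_norm// addr_ge0 ?mulr_ge0.
  case=> [|[|[|]]] [_ <-]; rewrite /det2 /= -[RHS]h -[RHS]normrN;
    by congr (`| _ |); ring.
- by move=> a b c d; exact: chain_of_fits.
- by move=> a b c d; exact: chain_of_fits.
- by move=> a b c d; exact: chain_of_fits.
- by move=> a b c d; exact: chain_of_fits.
- by move=> a b c d; exact: chain_of_fits.
- by move=> a b c d [[? ? ? ?] h]; split => //; tauto.
- by move=> a b c d [[? ? ? ?] h]; split => //; tauto.
- move=> a b c d [[a0 b0 c0 d0] h] db; split.
    by split=> //; [exact: addr_ge0|rewrite subr_ge0].
  case: h => [h|[h|[h|h]]]; [left|right; left|right; right; left|right; right; right].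
  + by apply: (basis_of_comb (i := 1) (j := 1) (k := 0) (l := 1)) h => //=;
      congr pair; ring.
  + by apply: (basis_of_comb (i := 1) (j := 0) (k := 1) (l := 1)) h => //=;
      congr pair; ring.
  + by apply: (basis_of_comb (i := 1) (j := -1) (k := 0) (l := 1)) h => //=;
      congr pair; ring.
  + by apply: (basis_of_comb (i := 1) (j := 0) (k := -1) (l := 1)) h => //=;
      congr pair; ring.
Qed.

(** * Finiteness of bounded bases and existence of a starting basis *)

Lemma finite_lattice_box (R : realType) (u v : R * R) (M : R) :
  det2 u v != 0 -> finite_set (lattice u v `&` box M).
Proof.
move=> D0.
have finZ (N : R) : finite_set [set i : int | `|i%:~R| <= N :> R].
  pose m := Num.truncn N.
  apply: (@sub_finite_set _ _
    [set i : int | i \in [seq t%:Z - m%:Z | t <- iota 0 (2 * m + 1)]]).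
    move=> i /= iN; apply/mapP.
    have im : (`|i| <= m)%N.
      by rewrite truncn_ge_nat ?natr_absz ?intr_norm// (le_trans _ iN).
    by exists `|(i + m%:Z)%R|%N; rewrite ?mem_iota; lia.
  by apply/finite_seqP; eexists.
(* Cramer's rule bounds both coefficients of a lattice point in the box by [N]. *)
pose N := M * (`|u.1| + `|u.2| + `|v.1| + `|v.2|) / `|det2 u v|.
apply: (@sub_finite_set _ _
  [set (ij.1%:~R * u.1 + ij.2%:~R * v.1, ij.1%:~R * u.2 + ij.2%:~R * v.2) |
   ij in [set i : int | `|i%:~R| <= N :> R] `*` [set i : int | `|i%:~R| <= N :> R]]).
  move=> _ [[i [j ->]] [/= h1 h2]].
  exists (i, j) => //.
  set x := _ + _ in h1; set y := _ + _ in h2.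
  have D1 : 0 < `|det2 u v| by rewrite normr_gt0.
  have M0 : 0 <= M by exact: le_trans h1.
  have key (a b : R) : `|x * a - y * b| <= M * (`|a| + `|b|).
    apply: le_trans (ler_normB _ _) _; rewrite !normrM mulrDr lerD//;
    by rewrite ler_wpM2r.
  split => /=; rewrite /N ler_pdivlMr// -normrM.
    have -> : i%:~R * det2 u v = x * v.2 - y * v.1 by rewrite /det2 /x /y; ring.
    by apply: le_trans (key _ _) _; rewrite ler_wpM2l//;
      have := normr_ge0 u.1; have := normr_ge0 u.2; lra.
  have -> : j%:~R * det2 u v = - (x * u.2 - y * u.1) by rewrite /det2 /x /y; ring.
  by rewrite normrN; apply: le_trans (key _ _) _; rewrite ler_wpM2l//;
    have := normr_ge0 v.1; have := normr_ge0 v.2; lra.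
by apply: finite_image; apply: finite_setX.
Qed.

Lemma lattice_generators (R : realType) (u v : R * R) :
  lattice u v u /\ lattice u v v.
Proof.
split; [exists 1, 0|exists 0, 1]; rewrite [LHS]surjective_pairing;
by congr pair; ring.
Qed.

Lemma finite_bases (R : realType) (u v : R * R) (D M : R) : det2 u v != 0 ->
  finite_set [set z : (R * R) * (R * R) |
    basis_of (lattice u v) D z.1 z.2 /\ (box M z.1 /\ box M z.2)].
Proof.
move=> D0; apply: (@sub_finite_set _ _
  ((lattice u v `&` box M) `*` (lattice u v `&` box M))).
  move=> [u' v'] [[/= <- _] [bu bv]].
  by have [? ?] := lattice_generators u' v'.
by apply: finite_setX; apply: finite_lattice_box.
Qed.

Lemma finite_chain_of (R : realType) (u v : R * R) (D M : R) : det2 u v != 0 ->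
  finite_set [set z : R * R * R * R |
    chain_of (lattice u v) D z.1.1.1 z.1.1.2 z.1.2 z.2 /\
    [/\ z.1.1.1 <= M, z.1.1.2 <= M, z.1.2 <= M & z.2 <= M]].
Proof.
move=> D0; have fin := finite_bases D M D0.
set B := (X in finite_set X) in fin.
(* The maps [f1] to [f4] recover [(a, b, c, d)] from the basis in each alternative of [chain_of]. *)
pose f1 (z : (R * R) * (R * R)) := (z.1.1, z.1.2, z.2.1, - z.2.2).
pose f2 (z : (R * R) * (R * R)) := (z.2.1, - z.2.2, z.1.1, z.1.2).
pose f3 (z : (R * R) * (R * R)) := (z.1.2, z.1.1, - z.2.2, z.2.1).
pose f4 (z : (R * R) * (R * R)) := (- z.2.2, z.2.1, z.1.2, z.1.1).
apply: (@sub_finite_set _ _ (f1 @` B `|` f2 @` B `|` f3 @` B `|` f4 @` B)).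
  move=> [[[a b] c] d] [[/= [a0 b0 c0 d0] h] [aM bM cM dM]].
  case: h => [h|[h|[h|h]]].
  - left; left; left; exists ((a, b), (c, - d)); last by rewrite /f1/= opprK.
    by split => //; split; split; rewrite /= ?normrN ger0_norm.
  - left; left; right; exists ((c, d), (a, - b)); last by rewrite /f2/= opprK.
    by split => //; split; split; rewrite /= ?normrN ger0_norm.
  - left; right; exists ((b, a), (d, - c)); last by rewrite /f3/= opprK.
    by split => //; split; split; rewrite /= ?normrN ger0_norm.
  - right; exists ((d, c), (b, - a)); last by rewrite /f4/= opprK.
    by split => //; split; split; rewrite /= ?normrN ger0_norm.
by rewrite !finite_setU; do !split; exact: finite_image.
Qed.

(* An l1-minimal basis gets nonnegative [a, b, c, d] after sign changes, a swap
   and at most one subtraction. *)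
Lemma chain_of_exists (R : realType) (u v : R * R) : det2 u v != 0 ->
  exists a b c d, chain_of (lattice u v) `|det2 u v| a b c d.
Proof.
move=> D0; set L := lattice u v; set D := `|det2 u v|.
pose f (z : (R * R) * (R * R)) := `|z.1.1| + `|z.1.2| + `|z.2.1| + `|z.2.2|.
pose M := f (u, v).
have Luv : basis_of L D u v by [].
have normf z : f z <= M -> box M z.1 /\ box M z.2.
  rewrite /f => fz; have := normr_ge0 z.1.1; have := normr_ge0 z.1.2.
  by have := normr_ge0 z.2.1; have := normr_ge0 z.2.2; split; split => /=; lra.
have finS : finite_set [set z | basis_of L D z.1 z.2 /\ f z <= M].
  by apply: sub_finite_set (finite_bases D M D0) => z [Bz /normf].
have [|[[x1 y1] [x2 y2]] [/= Bz fz] zmin] := finite_set_argmin f finS.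
  by exists (u, v).
have zmin' z : basis_of L D z.1 z.2 -> f ((x1, y1), (x2, y2)) <= f z.
  move=> Bz'; have [fz'|/ltW fz'] := leP (f z) M; last exact: le_trans fz'.
  exact: (zmin z).
have nz x2' y2' x1' y1' : basis_of L D (x1', y1') (x2', y2') ->
    x2' = 0 -> y2' = 0 -> False.
  move=> [_ /= h] e1 e2; move: D0; rewrite -normr_gt0 -/D -h /det2/= e1 e2.
  by rewrite !mulr0 subrr normr0 ltxx.
have opu a b w : basis_of L D (a, b) w -> basis_of L D (- a, - b) w.
  apply: (basis_of_comb (i := -1) (j := 0) (k := 0) (l := 1)) => //=; last first.
    by rewrite [LHS]surjective_pairing; congr pair; ring.
  by congr pair; ring.
have swp w w' : basis_of L D w w' -> basis_of L D w' w.
  apply: (basis_of_comb (i := 0) (j := 1) (k := 1) (l := 0)) => //=;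
  by rewrite [LHS]surjective_pairing; congr pair; ring.
have opv a b w : basis_of L D w (a, b) -> basis_of L D w (- a, - b).
  by move=> /swp /opu /swp.
have subu a b c d : basis_of L D (a, b) (c, d) -> basis_of L D (a - c, b - d) (c, d).
  by apply: (basis_of_comb (i := 1) (j := -1) (k := 0) (l := 1)) => //=;
    congr pair; ring.
have {zmin' zmin Bz fz} [a [b [c [d [a0 c0 B0 minB]]]]] : exists a b c d,
    [/\ 0 <= a, 0 <= c, basis_of L D (a, b) (c, d) &
    forall z, basis_of L D z.1 z.2 -> a + `|b| + c + `|d| <= f z].
  have [x1n|x1p] := leP x1 0; have [x2n|x2p] := leP x2 0.
  - exists (- x1), (- y1), (- x2), (- y2); split; rewrite ?oppr_ge0//.
      exact/opu/opv.
    by move=> z /zmin'; rewrite /f/= !normrN (ler0_norm x1n) (ler0_norm x2n).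
  - exists (- x1), (- y1), x2, y2; split; rewrite ?oppr_ge0 ?(ltW x2p)//.
      exact/opu.
    by move=> z /zmin'; rewrite /f/= !normrN (ler0_norm x1n) (gtr0_norm x2p).
  - exists x1, y1, (- x2), (- y2); split; rewrite ?oppr_ge0 ?(ltW x1p)//.
      exact/opv.
    by move=> z /zmin'; rewrite /f/= !normrN (gtr0_norm x1p) (ler0_norm x2n).
  - exists x1, y1, x2, y2; split; rewrite ?(ltW x1p) ?(ltW x2p)//.
    by move=> z /zmin'; rewrite /f/= (gtr0_norm x1p) (gtr0_norm x2p).
wlog ac : a b c d a0 c0 B0 minB / c <= a.
  move=> wl; have [ca|/ltW ca] := leP c a; first exact: wl B0 minB ca.
  apply: (wl c d a b) => //; first exact: swp.
  by move=> z /minB; lra.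
have B1 := subu _ _ _ _ B0.
have ac0 : 0 <= a - c by rewrite subr_ge0.
(* Minimality against [u - v] reads [|b| + c <= |b - d|]. If [b] and [d] have the same sign and
   [|d| <= |b|], this forces [c + |d| <= 0], so [(c, d)] would vanish. *)
have f1 := minB ((a - c, b - d), (c, d)) B1.
rewrite /f /= (ger0_norm c0) (ger0_norm ac0) in f1.
have small : c + `|d| <= 0 -> False.
  have := normr_ge0 d => d0 cd; apply: (nz c d a b) => //; first lra.
  by apply/normr0_eq0; lra.
have [b0|/ltW b0] := leP 0 b; have [d0|/ltW d0] := leP 0 d.
- have [bd|/ltW bd] := leP d b.
    exfalso; apply: small; move: f1.
    by rewrite !ger0_norm ?subr_ge0//; lra.
  exists c, d, (a - c), (d - b); split; first by rewrite !subr_ge0.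
  by left; rewrite opprB; exact: swp.
- exists a, b, c, (- d); split; first by rewrite oppr_ge0.
  by left; rewrite opprK.
- exists c, d, a, (- b); split; first by rewrite oppr_ge0.
  by left; rewrite opprK; exact: swp.
- have [bd|/ltW bd] := leP b d.
    exfalso; apply: small; move: f1.
    by rewrite !ler0_norm ?subr_le0//; lra.
  exists (a - c), (b - d), c, (- d); split; first by rewrite !subr_ge0 oppr_ge0.
  by left; rewrite opprK.
Qed.

(** * The determinant bound for piercing lattices and the comparison of densities *)

Lemma piercing_lattice_det_le5 (R : realType) (u v : R * R) : det2 u v != 0 ->
  pierces (lattice u v) 6 1 -> pierces (lattice u v) 4 2 ->
  pierces (lattice u v) 3 3 -> pierces (lattice u v) 2 4 ->
  pierces (lattice u v) 1 6 -> `|det2 u v| <= 5.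
Proof.
move=> D0 p61 p42 p33 p24 p16.
apply: (chain_det_le5 (Q := chain_of (lattice u v) `|det2 u v|)).
- exact: basis_chain_of.
- exact: chain_of_exists.
- by move=> M; exact: finite_chain_of.
Qed.

Theorem theorem6 (R : realType) :
  exists F : seq (R * R * R * R),
    size F = 5%N /\ uniq F /\ (forall q, q \in F -> proper_rect q) /\
    ((6 / 5 : R)%:E * pi_dens F <= pi_lat F)%E.
Proof.
pose q (w h : R) : R * R * R * R := (0, w, 0, h).
pose F := [:: q 6 1; q 4 2; q 3 3; q 2 4; q 1 6].
exists F; split => //; split.
  by rewrite /= !inE /q !xpair_eqE !(eqr_nat, pnatr_eq1) /= ?andbF.
split.
  by move=> z; rewrite !inE => /or4P[|||/orP[]] /eqP ->; split => /=; lra.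
(* The value [1/5 = 6/5 * 1/6] separates the two sides. *)
apply: (@le_trans _ _ (5^-1)%:E).
  apply: (@le_trans _ _ ((6 / 5 : R)%:E * (6^-1)%:E)%E); last first.
    by rewrite -EFinM lee_fin; lra.
  rewrite lee_pmul2l//.
  apply: ge_ereal_inf; exists (density (hexset R)); last first.
    exact: (density_le (@count_hexset R)).
  exists (hexset R) => // z.
  rewrite !inE => /or4P[|||/orP[]] /eqP ->; apply/piercesE.
  - exact: (@hexset_block R 6 1).
  - exact: (@hexset_block R 4 2).
  - exact: (@hexset_block R 3 3).
  - exact: (@hexset_block R 2 4).
  - exact: (@hexset_block R 1 6).
apply: le_ereal_inf_tmp => _ [[u v] /= [D0 pL] <-].
rewrite lee_fin lef_pV2 ?posrE ?normr_gt0//.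
by apply: piercing_lattice_det_le5 => //; apply/piercesE/pL;
  rewrite !inE eqxx ?orbT.
Qed.
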